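(* Let $X$ be a connected reduced curve. The poset $\mathrm{VStab}(X)$ satisfies the following two properties: (i) a V-stability condition $\mathfrak s\in\mathrm{VStab}(X)$ is maximal in $\mathrm{VStab}(X)$ if and only if $\mathcal D(\mathfrak s)=\emptyset$ (i.e. $\mathfrak s$ is general); (ii) a V-stability condition $\mathfrak s\in\mathrm{VStab}(X)$ is submaximal in $\mathrm{VStab}(X)$, i.e. it is not maximal and it is dominated only by maximal elements, if and only if $\mathcal D(\mathfrak s)=\{Y,Y^{\mathsf c}\}$ for some $Y\in\mathrm{BCon}(X)$.
   Context: $X$ is a connected reduced projective curve over an algebraically closed field. A subcurve $Y\subseteq X$ is a union of some (possibly none, possibly all) irreducible components; $Y^{\mathsf c}:=\overline{X\setminus Y}$. $\mathrm{BCon}(X)$ is the set of subcurves $Y\ne\emptyset,X$ with $Y$ and $Y^{\mathsf c}$ both connected. A V-stability condition of characteristic $\chi\in\mathbb Z$ on $X$ is a function $\mathfrak s:\mathrm{BCon}(X)\to\mathbb Z$ such that: (1) for all $Y\in\mathrm{BCon}(X)$, $\mathfrak s_Y+\mathfrak s_{Y^{\mathsf c}}-\chi\in\{0,1\}$; $Y$ is $\mathfrak s$-degenerate if this number is $0$ and $\mathfrak s$-nondegenerate otherwise; (2) for all $Y_1,Y_2,Y_3\in\mathrm{BCon}(X)$ pairwise without common irreducible components and with $X=Y_1\cup Y_2\cup Y_3$: (a) if two of the $Y_i$ are $\mathfrak s$-degenerate, so is the third; (b) $\sum_{i=1}^3\mathfrak s_{Y_i}-\chi$ lies in $\{1,2\}$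 if all $Y_i$ are $\mathfrak s$-nondegenerate, in $\{1\}$ if exactly one is $\mathfrak s$-degenerate, and in $\{0\}$ if all are $\mathfrak s$-degenerate. The characteristic of $\mathfrak s$ is denoted $|\mathfrak s|$, and $\mathcal D(\mathfrak s):=\{Y\in\mathrm{BCon}(X): Y\text{ is }\mathfrak s\text{-degenerate}\}$. $\mathrm{VStab}(X)$ is the set of all V-stability conditions on $X$ (of all characteristics), ordered by: $\mathfrak s\ge\mathfrak t$ iff $|\mathfrak s|=|\mathfrak t|$ and $\mathfrak s_Y\ge\mathfrak t_Y$ for all $Y\in\mathrm{BCon}(X)$. ''Dominated only by maximal elements'' means that every element strictly greater than $\mathfrak s$ is maximal. *)

(* Defs.v *)
From HB Require Import structures.
From mathcomp Require Import all_boot all_order all_algebra.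
(* The notations of mpoly clash with those of mathcomp-analysis. *)
From mathcomp Require Import -(notations) mpoly.
From mathcomp Require Import boolp classical_sets topology.

Set Implicit Arguments.
Unset Strict Implicit.
Unset Printing Implicit Defensive.

Import GRing.Theory.
Local Open Scope ring_scope.
Local Open Scope classical_set_scope.

(* P^n(k): the lines through the origin of k^(n+1). *)
Definition pspace (k : fieldType) (n : nat) :=
  {L : {vspace 'rV[k]_n.+1} | \dim L == 1%N}.

HB.instance Definition _ (k : fieldType) (n : nat) :=
  Choice.on (pspace k n).

Section ZariskiTopology.
Context (k : fieldType) (n : nat).
Implicit Types (f g : mpoly n.+1 k) (L : pspace k n).

Definition homogeneous f : Prop := exists d : nat, f \is ishomog1 d mdeg.

Definition vanishes f L : Prop :=
  forall v : 'rV[k]_n.+1, v \in val L -> meval (v ord0) f = 0.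

Definition zero_locus (F : set (mpoly n.+1 k)) : set (pspace k n) :=
  [set L | forall f, F f -> vanishes f L].

Definition zariski_open (U : set (pspace k n)) : Prop :=
  exists2 F, F `<=` homogeneous & ~` U = zero_locus F.

Lemma meval_homogZ (d : nat) f (c : k) (v : 'rV[k]_n.+1) :
  f \is ishomog1 d mdeg ->
  meval ((c *: v) ord0) f = c ^+ d * meval (v ord0) f.
Proof.
move=> /dhomogP hf; rewrite !mevalE big_distrr /=.
rewrite !big_seq; apply: eq_bigr => m /hf hm.
rewrite mulrCA; congr (_ * _).
under eq_bigr do rewrite mxE exprMn.
by rewrite big_split /= -expr_sum -mdegE hm.
Qed.

Lemma vanishes_line f L : homogeneous f ->
  vanishes f L <-> meval ((vpick (val L)) ord0) f = 0.
Proof.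
move=> [d hf]; split=> [|h0 v]; first by apply; exact: memv_pick.
case: L h0 => L /= dL h0 vL.
have nzp : vpick L != 0 by rewrite vpick0 -dimv_eq0 (eqP dL).
have /eqP LE : (<[vpick L]> == L)%VS.
  by rewrite eqEdim (eqP dL) dim_vline nzp andbT -memvE memv_pick.
move: vL; rewrite -{1}LE => /vlineP[c ->].
by rewrite (meval_homogZ _ _ hf) h0 mulr0.
Qed.

Lemma zariski_openT : zariski_open setT.
Proof.
exists [set 1].
  by move=> _ ->; exists 0%N; exact: dhomog1.
rewrite setCT; apply/esym/seteqP; split=> // L /(_ 1 erefl) h.
have := h 0 (mem0v _); rewrite meval1 => /eqP.
by rewrite oner_eq0.
Qed.

Lemma zariski_openI : setI_closed zariski_open.
Proof.
move=> U V [F hF UF] [G hG VG].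
exists [set h | exists f g, [/\ F f, G g & h = f * g]].
  move=> _ [f [g [/hF[d fd] /hG[e ge] ->]]].
  by exists (d + e)%N; exact: dhomogM.
rewrite setCI UF VG; apply/seteqP; split=> L.
  move=> [h|h] _ [f [g [Ff Gg ->]]] v vL; rewrite mevalM.
    by rewrite (h _ Ff _ vL) mul0r.
  by rewrite (h _ Gg _ vL) mulr0.
move=> h; apply/or_asboolP/negPn/negP; rewrite negb_or => /andP[].
move=> /asboolPn /existsNP[f] /not_implyP[Ff nf].
move=> /asboolPn /existsNP[g] /not_implyP[Gg ng].
have [d fd] := hF _ Ff; have [e ge] := hG _ Gg.
have hfg : homogeneous (f * g) by exists (d + e)%N; exact: dhomogM.
have /(vanishes_line _ hfg) : vanishes (f * g) L by apply: h; exists f, g.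
rewrite mevalM => /eqP; rewrite mulf_eq0 => /orP[] /eqP h0.
  by apply: nf; apply/vanishes_line => //; exists d.
by apply: ng; apply/vanishes_line => //; exists e.
Qed.

Lemma zariski_open_bigU (I : Type) (U : I -> set (pspace k n)) :
  (forall i, zariski_open (U i)) -> zariski_open (\bigcup_i U i).
Proof.
move=> hU.
have /choice[F hF] : forall i, exists F, F `<=` homogeneous /\ ~` U i = zero_locus F.
  by move=> i; have [F ? ?] := hU i; exists F.
exists (\bigcup_i F i).
  by move=> f [i _]; case: (hF i) => + _; apply.
rewrite setC_bigcup; apply/seteqP; split=> L hL.
  move=> f [i _ Ff]; have := hL i Logic.I; case: (hF i) => _ ->; exact.
move=> i _; case: (hF i) => _ -> f Ff; apply: hL; by exists i.
Qed.

HB.instance Definition _ := isOpenTopological.Build (pspace k n)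
  zariski_openT zariski_openI zariski_open_bigU.

Lemma zariski_closedE (A : set (pspace k n)) :
  closed A <-> exists2 F, F `<=` homogeneous & A = zero_locus F.
Proof. by rewrite -openC; split=> -[F hF E]; exists F; rewrite ?setCK // -E setCK. Qed.

End ZariskiTopology.

Section Irreducibility.
Context (T : topologicalType).
Implicit Types (X Y Z A B C : set T).

Definition irreducible A : Prop :=
  A !=set0 /\
  forall B C, closed B -> closed C -> A `<=` B `|` C -> A `<=` B \/ A `<=` C.

Definition irreducible_component X Z : Prop :=
  [/\ irreducible Z, Z `<=` X &
      forall W, irreducible W -> W `<=` X -> Z `<=` W -> W = Z].

Definition irreducible_chain X (d : nat) : Prop :=
  exists Z : nat -> set T,
    (forall i, (i <= d)%N -> [/\ irreducible (Z i), closed (Z i) & Z i `<=` X])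
    /\ (forall i, (i < d)%N -> Z i `<` Z i.+1).

(* For closed X: the Krull dimension of X is d. *)
Definition has_dimension X (d : nat) : Prop :=
  irreducible_chain X d /\ ~ irreducible_chain X d.+1.

(* Unions of arbitrary sets of components; a curve has finitely many. *)
Definition subcurve X Y : Prop :=
  exists2 S : set (set T), S `<=` irreducible_component X
    & Y = \bigcup_(Z in S) Z.

Definition compl X Y : set T := closure (X `\` Y).

Definition BCon X : set (set T) :=
  [set Y | [/\ subcurve X Y, Y <> set0, Y <> X,
               connected Y & connected (compl X Y)]].

Definition no_common_component Y1 Y2 : Prop :=
  ~ exists Z, irreducible_component Y1 Z /\ irreducible_component Y2 Z.

End Irreducibility.

(* A reduced projective scheme over an algebraically closed field k is
   identified with the Zariski closed set of its k-points in some P^n(k). *)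
Definition projective_curve (k : closedFieldType) (n : nat)
    (X : set (pspace k n)) : Prop :=
  [/\ closed X, X !=set0 &
      forall Z, irreducible_component X Z -> has_dimension Z 1].

Section VStability.
Context (T : topologicalType) (X : set T).
Implicit Types (chi : int) (Y : set T).

Definition defect chi (s : set T -> int) Y : int := s Y + s (compl X Y) - chi.

Definition degenerate chi (s : set T -> int) Y : Prop := defect chi s Y = 0.

Definition vstability_pair chi (s : set T -> int) : Prop :=
  forall Y, BCon X Y -> defect chi s Y = 0 \/ defect chi s Y = 1.

Definition vstability_triple chi (s : set T -> int) : Prop :=
  forall Y1 Y2 Y3, BCon X Y1 -> BCon X Y2 -> BCon X Y3 ->
    no_common_component Y1 Y2 -> no_common_component Y1 Y3 ->
    no_common_component Y2 Y3 -> X = Y1 `|` Y2 `|` Y3 ->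
    let D1 := degenerate chi s Y1 in
    let D2 := degenerate chi s Y2 in
    let D3 := degenerate chi s Y3 in
    let e := s Y1 + s Y2 + s Y3 - chi in
    [/\ [/\ D1 /\ D2 -> D3, D1 /\ D3 -> D2 & D2 /\ D3 -> D1],
        [/\ ~ D1, ~ D2 & ~ D3] -> e = 1 \/ e = 2,
        [\/ [/\ D1, ~ D2 & ~ D3], [/\ ~ D1, D2 & ~ D3]
          | [/\ ~ D1, ~ D2 & D3]] -> e = 1
      & [/\ D1, D2 & D3] -> e = 0].

(* A function BCon X -> int is represented by its extension by 0, so that
   Leibniz equality on VStab is equality of the characteristics and of the
   functions on BCon X. The characteristic is a separate field because the
   function does not determine it when BCon X is empty. *)
Record VStab := MkVStab {
  vchar : int;
  vfun :> set T -> int;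
  vfun_out : forall Y, ~ BCon X Y -> vfun Y = 0;
  vfun_pair : vstability_pair vchar vfun;
  vfun_triple : vstability_triple vchar vfun }.

Definition degenerate_locus (s : VStab) : set (set T) :=
  [set Y | BCon X Y /\ degenerate (vchar s) s Y].

Definition vle (t s : VStab) : Prop :=
  vchar t = vchar s /\ forall Y, BCon X Y -> (t Y <= s Y)%R.

Definition vlt (t s : VStab) : Prop := vle t s /\ t <> s.

Definition vmaximal (s : VStab) : Prop := ~ exists t, vlt s t.

Definition vsubmaximal (s : VStab) : Prop :=
  ~ vmaximal s /\ forall t, vlt s t -> vmaximal t.

Lemma vle_refl s : vle s s.
Proof. by split. Qed.

Lemma vle_trans t s u : vle s t -> vle t u -> vle s u.
Proof.
move=> [st hst] [tu htu]; split; first exact: etrans st tu.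
by move=> Y hY; apply: Order.POrderTheory.le_trans (hst _ hY) (htu _ hY).
Qed.

Lemma vle_anti s t : vle s t -> vle t s -> s = t.
Proof.
case: s t => [c f fo fp ft] [c' g go gp gt] [/= cc' fg] [_ /= gf].
subst c'; have fgE : f = g.
  apply/funext => Y; have [hY|hY] := pselect (BCon X Y); last by rewrite fo ?go.
  by apply: Order.POrderTheory.le_anti; rewrite fg ?gf.
subst g; rewrite (Prop_irrelevance fo go) (Prop_irrelevance fp gp).
by rewrite (Prop_irrelevance ft gt).
Qed.

End VStability.

(* Main.v *)
Require Import Defs.
From HB Require Import structures.
From mathcomp Require Import all_boot all_order all_algebra.
From mathcomp Require Import -(notations) mpoly.
From mathcomp Require Import boolp classical_sets topology.
From mathcomp Require Import cardinality zify.

Set Implicit Arguments.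
Unset Strict Implicit.
Unset Printing Implicit Defensive.

Import Order.TTheory GRing.Theory Num.Theory.
Local Open Scope classical_set_scope.

(** The idea is that a degenerate subcurve can be made nondegenerate by an
    arbitrarily small perturbation, and that such a perturbation can be
    carried out on the V-stability condition itself. For a condition of the form
    Y |-> ceil(phi Y), with phi a real-valued function, additive over components
    and of total mass chi, the degenerate Y are those with phi Y an integer, and
    replacing phi by phi + eps * eta, with eta additive of total mass 0 and
    eps > 0 small, adds 1 to the value at Y exactly when Y is degenerate and
    eta Y > 0, and changes no other value. This recipe makes sense for
    every V-stability condition s. It suffices to take eta = delta_a - delta_b
    for two irreducible components a and b of X, and the new condition is then

      t Y = s Y + 1  if Y is degenerate, contains a and does not contain b,
      t Y = s Y      otherwise                                        [raise].

    In a triple Y1, Y2, Y3 each of a and b lies in exactly one member, so the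
    axioms for t follow from those for s by a finite case check
    [triple_rule_raise]. The degenerate subcurves of t are the degenerate
    subcurves of s that do not separate a from b [degenerate_locus_raise].

    Conversely t >= s forces D(t) to be contained in D(s), and t = s if the two
    loci agree, because the sums s Y + s (compl Y) can take only two values
    [vle_degenerate_locus, vle_degenerate_locus_eq]. So s with D(s) empty is
    maximal; if Y is in D(s), choosing a in Y and b outside Y gives t > s. This
    is (i). For (ii), if D(s) = {Y, compl Y}, any t > s has a strictly smaller
    locus stable under complement, hence an empty one. If D(s) contains Y and
    some Z other than Y and compl Y, then some pair a, b is separated by Z and
    not by Y [BCon_separated]; raising along it gives a t > s that keeps Y
    degenerate and so is not maximal.

    All this treats subcurves as sets of irreducible components, with
    Y |-> compl Y as set complement. That is legitimate because X has finitely
    many irreducible components, which holds since projective space is a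
    noetherian space [pspace_noetherian]; this in turn follows from the
    ascending chain condition for ideals of polynomials
    [ideal_chain_stabilizes], obtained by comparing leading monomials. *)

(** * Chains of polynomial ideals *)

(** Jump repeatedly to a later place where u takes its least value from there
    on. *)
Lemma nondecreasing_subsequence (u : nat -> nat) :
  exists2 phi : nat -> nat, {homo phi : i j / (i < j)%N}
    & {homo u \o phi : i j / (i <= j)%N}.
Proof.
have /choice[next nextP] : forall N, exists p,
    (N <= p)%N /\ forall q, (N <= q)%N -> (u p <= u q)%N.
  move=> N.
  have ex : exists v, `[< exists2 p, (N <= p)%N & u p = v >].
    by exists (u N); apply/asboolP; exists N.
  case: (ex_minnP ex) => v /asboolP[p Np <-] min_v; exists p; split=> // q Nq.
  by apply: min_v; apply/asboolP; exists q.
pose phi := fix phi i := if i is j.+1 then next (phi j).+1 else next 0%N.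
have phiS i : (phi i < phi i.+1)%N by case: (nextP (phi i).+1).
exists phi; first by apply: homo_ltn phiS => ? ? ?; exact: ltn_trans.
apply: homo_leq => [//|? ? ?|]; first exact: leq_trans.
case=> [|i] /=.
  by case: (nextP 0%N) => _; apply.
by case: (nextP (phi i).+1) => _; apply; exact: ltn_trans (phiS i) (phiS _).
Qed.

(** Dickson's lemma, for exponent vectors indexed by J: passing to a subsequence
    once for each coordinate makes all coordinates nondecreasing. *)
Lemma dickson (J : finType) (m : nat -> J -> nat) :
  exists i j, (i < j)%N /\ forall x, (m i x <= m j x)%N.
Proof.
suff [phi phi_lt phi_le] : exists2 phi : nat -> nat,
    {homo phi : i j / (i < j)%N}
    & forall x, x \in enum J -> {homo (m^~ x) \o phi : i j / (i <= j)%N}.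
  exists (phi 0%N), (phi 1%N); split=> [|x]; first exact: phi_lt.
  by apply: (phi_le x) => //; rewrite mem_enum.
elim: (enum J) => [|y s [phi phi_lt phi_le]]; first by exists id.
have [psi psi_lt psi_le] := nondecreasing_subsequence ((m^~ y) \o phi).
exists (phi \o psi) => [i j ij /=|x]; first by apply: phi_lt; apply: psi_lt.
rewrite inE => /predU1P[-> //|xs] i j ij /=; apply: phi_le => //.
by move: ij; rewrite leq_eqVlt => /predU1P[->//|/psi_lt/ltnW].
Qed.

Section HilbertBasis.
Context (k : fieldType) (n : nat).
Local Open Scope ring_scope.
Implicit Types (f g h : mpoly n k) (I : set (mpoly n k)).

Definition ideal I := I 0 /\ forall h f g, I f -> I g -> I (h * f + g).

Lemma exists_min_mlead (P : set (mpoly n k)) : P !=set0 ->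
  exists2 f, P f & forall g, P g -> ~ (mlead g < mlead f)%O.
Proof.
move=> [f Pf]; apply: contrapT => nomin; move: f Pf.
elim/mleadrect => f IH Pf; apply: nomin; exists f => // g Pg gf.
exact: IH gf Pg.
Qed.

(** One step of the division algorithm: a monomial multiple of f cancels the
    leading term of g. *)
Lemma lead_reduction f g : f != 0 -> (forall x, (mlead f x <= mlead g x)%N) ->
  exists h, g - h * f = 0 \/ (mlead (g - h * f)%R < mlead g)%O.
Proof.
move=> nzf fg; pose d := mnm_sub (mlead g) (mlead f).
have dE : mnm_add d (mlead f) = mlead g by apply: submK; apply/mnm_lepP.
pose c := mcoeff (mlead g) g / mcoeff (mlead f) f.
pose h := c *: mpolyX k d; exists h.
have [->|nz] := eqVneq (g - h * f) 0; first by left.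
right; rewrite lt_neqAle; apply/andP; split.
  apply: contra nz => /eqP lead_eq.
  rewrite -mleadc_eq0 lead_eq mcoeffB /h -scalerAl mcoeffZ.
  rewrite [mpolyX k d * f]mulrC -{2}dE.
  by rewrite mcoeffMX /c divfK ?subrr// mleadc_eq0.
apply: (le_trans (mleadB_le _ _)); rewrite leUx lexx /=.
apply: (le_trans (mleadM_le _ _)); rewrite -dE; apply: lem_add => //.
by apply: (le_trans (mleadZ_le _ _)); rewrite mleadXm.
Qed.

(** In a chain without stable step, choose f i new in I i.+1 with the smallest
    possible leading monomial. Dickson's lemma gives i < j such that the leading
    monomial of f i divides that of f j; reducing f j by f i, which already lies
    in I j, gives an element new in I j.+1 with a smaller leading monomial. *)
Lemma ideal_chain_stabilizes (I : nat -> set (mpoly n k)) :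
  (forall i, ideal (I i)) -> (forall i, I i `<=` I i.+1) ->
  exists i, I i.+1 `<=` I i.
Proof.
move=> idI incI; apply: contrapT => strict.
have /choice[f fP] : forall i, exists f, (I i.+1 `\` I i) f /\
    forall g, (I i.+1 `\` I i) g -> ~ (mlead g < mlead f)%O.
  move=> i; have [|f Pf min_f] := @exists_min_mlead (I i.+1 `\` I i).
    apply: contrapT => nex; apply: strict; exists i => g Ig.
    by apply: contrapT => nIg; apply: nex; exists g.
  by exists f.
have incl i j : (i <= j)%N -> I i `<=` I j.
  apply: (@homo_leq _ I (fun A B => A `<=` B)) => [A|B A C|//].
    exact: subset_refl.
  exact: subset_trans.
have [i [j [ij fij]]] := dickson (fun i (x : 'I_n) => mlead (f i) x).
have [[Ifi nIfi] _] := fP i; have [[Ifj nIfj] min_fj] := fP j.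
have nzfi : f i != 0 by apply: contra_notN nIfi => /eqP->; case: (idI i).
have [h red] := lead_reduction nzfi fij.
have Ijfi : I j (f i) by apply: incl ij _ _.
have [[I0 Ilin] [_ Ilin']] := (idI j, idI j.+1).
have nIr : ~ I j (f j - h * f i).
  by move=> Ir; apply: nIfj; have := Ilin h _ _ Ijfi Ir; rewrite addrC subrK.
case: red => [r0|]; first by apply: nIr; rewrite r0.
apply: min_fj; split=> //; rewrite addrC -mulNr.
by apply: Ilin' => //; exact: incI.
Qed.

End HilbertBasis.

(** * Projective space is noetherian *)

Definition noetherian (T : topologicalType) :=
  forall C : nat -> set T, (forall i, closed (C i)) ->
    (forall i, C i.+1 `<=` C i) -> exists i, C i `<=` C i.+1.

Section PspaceNoetherian.
Context (k : fieldType) (n : nat).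
Local Open Scope ring_scope.

(** The polynomials are not required to be homogeneous: vanishing on a line
    means vanishing at each of its vectors, so that this set is an ideal. *)
Definition vanishing_ideal (A : set (pspace k n)) : set (mpoly n.+1 k) :=
  [set f | forall L, A L -> vanishes f L].

Lemma vanishing_ideal_ideal A : ideal (vanishing_ideal A).
Proof.
split=> [L _ v _|h f g hf hg L AL v vL]; first exact: meval0.
by rewrite mevalD mevalM (hf L)// (hg L)// mulr0 addr0.
Qed.

Lemma closed_sub_vanishing_ideal (A B : set (pspace k n)) : closed A ->
  vanishing_ideal A `<=` vanishing_ideal B -> B `<=` A.
Proof.
move=> /zariski_closedE[F _ ->] AB L BL f Ff.
have IAf : vanishing_ideal (zero_locus F) f by move=> M; exact.
exact: AB IAf _ BL.
Qed.

Lemma pspace_noetherian : noetherian (pspace k n).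
Proof.
move=> C clC decC.
have [i|i incl_i] := ideal_chain_stabilizes
  (fun i => vanishing_ideal_ideal (C i)).
  by move=> f hf L CL; apply: hf; exact: decC.
by exists i; apply: closed_sub_vanishing_ideal.
Qed.

End PspaceNoetherian.

(** * Irreducible components in noetherian spaces *)

Section NoetherianSpace.
Context (T : topologicalType).
Implicit Types (A B X Z : set T).

Lemma irreducible_sub_bigcup Z (S : set (set T)) : irreducible Z ->
  finite_set S -> S `<=` closed -> Z `<=` \bigcup_(A in S) A ->
  exists2 A, S A & Z `<=` A.
Proof.
move=> [[z Zz] irrZ] /finite_seqP[s ->] {S}.
elim: s => [|A s IH] cl cov; first by have [] := cov _ Zz.
have cls : [set` s] `<=` closed.
  by move=> B Bs; apply: cl; rewrite /= inE; apply/orP; right.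
case: (irrZ A (\bigcup_(B in [set` s]) B)).
- by apply: cl; rewrite /= mem_head.
- by apply: closed_bigcup => [|B /cls]; first exact: finite_seq.
- move=> x /cov[B /=]; rewrite inE => /predU1P[->|Bs] Bx; first by left.
  by right; exists B.
- by move=> ZA; exists A => //=; rewrite mem_head.
- move=> /(IH cls)[B Bs ZB]; exists B => //=.
  by rewrite inE; apply/orP; right.
Qed.

Lemma irreducible_closure Z : irreducible Z -> irreducible (closure Z).
Proof.
move=> [[z Zz] irrZ]; split; first by exists z; exact: subset_closure.
move=> B C clB clC cov.
have [||] := irrZ B C clB clC; first exact: subset_trans (@subset_closure _ _) cov.
- by move=> /closureS; rewrite -((closure_id B).1 clB); left.
- by move=> /closureS; rewrite -((closure_id C).1 clC); right.
Qed.

Lemma irreducible_component_closed X Z : closed X ->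
  irreducible_component X Z -> closed Z.
Proof.
move=> clX [irrZ ZX maxZ]; rewrite -(maxZ (closure Z)).
- exact: closed_closure.
- exact: irreducible_closure.
- by rewrite ((closure_id X).1 clX); exact: closureS.
- exact: subset_closure.
Qed.

Hypothesis noethT : noetherian T.

Lemma noetherian_induction (P : set T -> Prop) :
  (forall A, closed A ->
     (forall B, closed B -> B `<` A -> P B) -> P A) ->
  forall A, closed A -> P A.
Proof.
move=> IH A0 clA0; apply: contrapT => nPA0.
pose bad := {A : set T | closed A /\ ~ P A}.
have /choice[next nextP] : forall A : bad, exists B : bad, sval B `<` sval A.
  move=> [A [clA nPA]] /=; apply: contrapT => nex; apply: nPA.
  apply: IH => // B clB BA; apply: contrapT => nPB.
  by apply: nex; exists (exist _ B (conj clB nPB)).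
pose C i := iter i next (exist _ A0 (conj clA0 nPA0) : bad).
have [||i] := noethT (C := fun i => sval (C i)).
- by move=> i; case: (svalP (C i)).
- by move=> i; case: (nextP (C i)).
- by case: (nextP (C i)).
Qed.

Lemma closed_irreducible_cover A : closed A ->
  exists2 s : seq (set T), forall Z, Z \in s -> irreducible Z /\ closed Z
    & A = \bigcup_(Z in [set` s]) Z.
Proof.
move: A; apply: noetherian_induction => A clA IH.
have [->|/set0P A0] := eqVneq A set0.
  by exists [::] => //; rewrite set_nil bigcup_set0.
have [irrA|nirrA] := pselect (irreducible A).
  exists [:: A] => [Z|]; first by rewrite inE => /eqP->.
  by rewrite set_cons1 bigcup_set1.
have [B [C [clB clC ABC nAB nAC]]] : exists B C,
    [/\ closed B, closed C, A `<=` B `|` C, ~ A `<=` B & ~ A `<=` C].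
  apply: contrapT => nex; apply: nirrA; split=> // B C clB clC ABC.
  have [AB|nAB] := pselect (A `<=` B); first by left.
  by right; apply: contrapT => nAC; apply: nex; exists B, C.
have proper D : ~ A `<=` D -> A `&` D `<` A.
  by move=> nAD; split=> [|AAD]; [exact: subIsetl|apply: nAD => x /AAD[]].
have [s sP sE] := IH (A `&` B) (closedI clA clB) (proper _ nAB).
have [t tP tE] := IH (A `&` C) (closedI clA clC) (proper _ nAC).
exists (s ++ t) => [Z|]; first by rewrite mem_cat => /orP[/sP|/tP].
have -> : [set` s ++ t] = [set` s] `|` [set` t].
  apply/seteqP; split=> Z /=; first by rewrite mem_cat => /orP.
  by rewrite mem_cat => /orP.
by rewrite bigcup_setU -sE -tE -setIUr; apply/esym/setIidPl.
Qed.

(** In a cover of X by irreducible closed sets with the least possible number of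
    members, no member contains another; such a cover consists of all the
    irreducible components of X. *)
Lemma finite_irreducible_components X : closed X ->
  finite_set (irreducible_component X) /\
  X `<=` \bigcup_(Z in irreducible_component X) Z.
Proof.
move=> clX.
have ex : exists m, `[< exists s : seq (set T), [/\ size s = m,
    forall Z, Z \in s -> irreducible Z /\ closed Z
    & X = \bigcup_(Z in [set` s]) Z] >].
  have [s sP sE] := closed_irreducible_cover clX.
  by exists (size s); apply/asboolP; exists s.
case: (ex_minnP ex) => m /asboolP[s [<- sP XE]] min_m {ex}.
have in_s W : irreducible W -> W `<=` X -> exists2 Z, Z \in s & W `<=` Z.
  move=> irrW WX; apply: (@irreducible_sub_bigcup W [set` s]) => //.
  - by move=> Z /sP[].
  - by rewrite -XE.
have comp_s : irreducible_component X = [set` s].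
  apply/seteqP; split=> [Z [irrZ ZX maxZ]|Z /= Zs].
    have [W Ws ZW] := in_s Z irrZ ZX; rewrite /= -(maxZ W) //.
      by case: (sP _ Ws).
    by rewrite XE; exact: bigcup_sup.
  have ZX : Z `<=` X by rewrite XE; exact: bigcup_sup.
  split=> [||W irrW WX ZW]; [by case: (sP _ Zs)|by []|].
  have [Z' Z's WZ'] := in_s W irrW WX.
  have [Z'Z|neq] := eqVneq Z' Z.
    by apply/seteqP; split=> //; rewrite -Z'Z.
  suff /min_m : `[< exists s' : seq (set T), [/\ size s' = (size s).-1,
      forall Z, Z \in s' -> irreducible Z /\ closed Z
      & X = \bigcup_(Z in [set` s']) Z] >].
    by rewrite leqNgt ltn_predL; case: (s) Zs.
  (* As Z lies in another member Z', dropping Z still leaves a cover. *)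
  apply/asboolP; exists (rem Z s); rewrite size_rem//; split=> //.
    by move=> Y /mem_rem/sP.
  apply/seteqP; split=> x; last first.
    by move=> [Y /= /mem_rem Ys Yx]; rewrite XE; exists Y.
  rewrite {1}XE => -[Y /= Ys Yx].
  have [YZ|nYZ] := eqVneq Y Z.
    exists Z'; last by apply/WZ'/ZW; rewrite -YZ.
    by move: (perm_to_rem Zs) Z's => /perm_mem->; rewrite inE (negPf neq).
  exists Y => //=.
  by move: (perm_to_rem Zs) Ys => /perm_mem->; rewrite inE (negPf nYZ).
by rewrite comp_s -XE; split.
Qed.

End NoetherianSpace.

(** * Subcurves as sets of components *)

Section Subcurves.
Context (T : topologicalType) (X : set T).
Hypothesis finX : finite_set (irreducible_component X).
Hypothesis clX : closed X.
Hypothesis coverX : X `<=` \bigcup_(Z in irreducible_component X) Z.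
Implicit Types (Y Z : set T).

Local Notation component := (irreducible_component X).

(** A subcurve determines the set of components of which it is the union; this
    uses that the set is finite. *)
Lemma component_sub_bigcup (S : set (set T)) Z : S `<=` component ->
  component Z -> Z `<=` \bigcup_(W in S) W -> S Z.
Proof.
move=> SX [irrZ ZX maxZ] ZS.
have [||W SW ZW] := irreducible_sub_bigcup irrZ _ _ ZS.
- exact: sub_finite_set finX.
- by move=> W /SX; exact: irreducible_component_closed.
by have [irrW WX _] := SX _ SW; rewrite -(maxZ W irrW WX ZW).
Qed.

Lemma bigcup_components_closed (S : set (set T)) : S `<=` component ->
  closed (\bigcup_(W in S) W).
Proof.
move=> SX; apply: closed_bigcup => [|W /SX]; first exact: sub_finite_set finX.
exact: irreducible_component_closed.
Qed.

Lemma subcurveE Y : subcurve X Y ->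
  Y = \bigcup_(Z in [set Z | component Z /\ Z `<=` Y]) Z.
Proof.
move=> [S SX ->]; apply/seteqP; split=> x [Z].
  by move=> SZ Zx; exists Z => //; split; [exact: SX|exact: bigcup_sup].
by case=> _ ZS Zx; exact: ZS.
Qed.

Lemma subcurve_closed Y : subcurve X Y -> closed Y.
Proof. by move=> [S SX ->]; exact: bigcup_components_closed. Qed.

Lemma subcurve_sub Y : subcurve X Y -> Y `<=` X.
Proof. by move=> [S SX ->] x [Z /SX[_ ZX _] /ZX]. Qed.

Lemma subcurve_ext Y Y' : subcurve X Y -> subcurve X Y' ->
  (forall Z, component Z -> Z `<=` Y <-> Z `<=` Y') -> Y = Y'.
Proof.
move=> sY sY' YY'; rewrite (subcurveE sY) (subcurveE sY').
by congr (bigcup _ _); apply/seteqP; split=> Z [cZ /(YY' _ cZ)].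
Qed.

(** A component Z outside Y is covered by Y and compl X Y, hence lies in the
    latter by irreducibility. *)
Lemma complE Y : subcurve X Y ->
  compl X Y = \bigcup_(Z in [set Z | component Z /\ ~ Z `<=` Y]) Z.
Proof.
move=> sY; apply/seteqP; split.
  have /closure_id -> : closed
      (\bigcup_(Z in [set Z | component Z /\ ~ Z `<=` Y]) Z).
    by apply: bigcup_components_closed => Z [].
  apply: closureS => x [/coverX[Z cZ Zx] nYx].
  by exists Z => //; split=> // /(_ _ Zx).
move=> x [Z [cZ nZY] Zx]; have [[_ irrZ] ZX _] := cZ.
have [|| //|ZC] := irrZ Y (compl X Y) (subcurve_closed sY).
- exact: closed_closure.
- move=> y Zy; have [Yy|nYy] := pselect (Y y); [by left|right].
  by apply: subset_closure; split=> //; exact: ZX.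
- exact: ZC.
Qed.

Lemma compl_subcurve Y : subcurve X Y -> subcurve X (compl X Y).
Proof.
move=> /complE ->; exists [set Z | component Z /\ ~ Z `<=` Y] => //.
by move=> Z [].
Qed.

Lemma sub_compl Y Z : subcurve X Y -> component Z ->
  Z `<=` compl X Y <-> ~ Z `<=` Y.
Proof.
move=> sY cZ; rewrite complE //; split=> [ZC|nZY]; last exact: bigcup_sup.
have SX : [set W | component W /\ ~ W `<=` Y] `<=` component by move=> W [].
by have [] := component_sub_bigcup SX cZ ZC.
Qed.

Lemma complK Y : subcurve X Y -> compl X (compl X Y) = Y.
Proof.
move=> sY; have sC := compl_subcurve sY.
apply: subcurve_ext => // [|Z cZ]; first exact: compl_subcurve.
rewrite sub_compl // sub_compl //; split=> [/contrapT//|ZY]; exact.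
Qed.

Lemma BCon_subcurve Y : BCon X Y -> subcurve X Y.
Proof. by case. Qed.

Lemma subcurve_neq0 Y : subcurve X Y -> Y <> set0 ->
  exists2 Z, component Z & Z `<=` Y.
Proof.
move=> sY /eqP/set0P[y]; rewrite {1}(subcurveE sY) => -[Z [cZ ZY] _].
by exists Z.
Qed.

Lemma subcurve_neqT Y : subcurve X Y -> Y <> X ->
  exists2 Z, component Z & ~ Z `<=` Y.
Proof.
move=> sY nYX; apply: contrapT => nex; apply: nYX; apply/seteqP.
split=> [|x /coverX[Z cZ Zx]]; first exact: subcurve_sub.
by have : Z `<=` Y; [apply: contrapT => nZY; apply: nex; exists Z|exact].
Qed.

Lemma BCon_compl Y : BCon X Y -> BCon X (compl X Y).
Proof.
move=> [sY Y0 YX connY connC].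
have [Z cZ ZY] := subcurve_neq0 sY Y0.
have [W cW nWY] := subcurve_neqT sY YX.
split=> //; last by rewrite complK.
- exact: compl_subcurve.
- move=> C0; have [[[w Ww] _] _ _] := cW.
  by have /(_ w Ww) := (sub_compl sY cW).2 nWY; rewrite C0.
- by move=> CX; apply/(sub_compl sY cZ): ZY; rewrite CX; case: cZ.
Qed.

Lemma component_of_subcurve Y Z : subcurve X Y -> component Z -> Z `<=` Y ->
  irreducible_component Y Z.
Proof.
move=> sY [irrZ ZX maxZ] ZY; split=> // W irrW WY; apply: maxZ => //.
exact: subset_trans (subcurve_sub sY).
Qed.

End Subcurves.

(** * Raising a V-stability condition along a pair of components *)

Section DegeneracyArithmetic.
Local Open Scope ring_scope.

(** The condition imposed on a triple, as a function of the excess e of its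
    values over the characteristic and of the degeneracy of its members. *)
Definition triple_rule (e : int) (D1 D2 D3 : Prop) : Prop :=
  [/\ [/\ D1 /\ D2 -> D3, D1 /\ D3 -> D2 & D2 /\ D3 -> D1],
      [/\ ~ D1, ~ D2 & ~ D3] -> e = 1 \/ e = 2,
      [\/ [/\ D1, ~ D2 & ~ D3], [/\ ~ D1, D2 & ~ D3]
        | [/\ ~ D1, ~ D2 & D3]] -> e = 1
    & [/\ D1, D2 & D3] -> e = 0].

(** Only the number of degenerate members matters, and it is never 2. *)
Lemma triple_ruleE (e : int) (d1 d2 d3 : bool) :
  triple_rule e d1 d2 d3 <->
  match (d1 + d2 + d3)%N with
  | 0 => e = 1 \/ e = 2
  | 1 => e = 1
  | 2 => False
  | _ => e = 0
  end.
Proof.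
split=> [[[h12 h13 h23] h0 h1 h3]|].
  case: d1 d2 d3 h12 h13 h23 h0 h1 h3 => [] [] [] /= h12 h13 h23 h0 h1 h3;
    by [exact: h3 | exact: notF (h12 _) | exact: notF (h13 _)
       | exact: notF (h23 _) | apply: h0; split | apply: h1; constructor 1
       | apply: h1; constructor 2 | apply: h1; constructor 3].
by case: d1 d2 d3 => [] [] [] //= he; split; do ?[split | by case | by []];
  case=> -[].
Qed.

(** The bits a_i and b_i tell whether the i-th member of the triple contains the
    component a, resp. b, so that a_i - b_i is the value of delta_a - delta_b on
    it. Members on which this value is not 0 become nondegenerate, and those on
    which it is 1 contribute to the excess. *)
Lemma triple_rule_raise (e : int) (d1 d2 d3 a1 a2 a3 b1 b2 b3 : bool) :
  (a1 + a2 + a3 = 1)%N -> (b1 + b2 + b3 = 1)%N -> triple_rule e d1 d2 d3 ->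
  triple_rule (e + (d1 && (a1 && ~~ b1))%:Z + (d2 && (a2 && ~~ b2))%:Z
                 + (d3 && (a3 && ~~ b3))%:Z)
    (d1 && (a1 == b1)) (d2 && (a2 == b2)) (d3 && (a3 == b3)).
Proof.
rewrite !triple_ruleE.
case: a1 a2 a3 => [] [] [] //= _; case: b1 b2 b3 => [] [] [] //= _;
  case: d1 d2 d3 => [] [] [] //=; lia.
Qed.

End DegeneracyArithmetic.

Section Raise.
Context (T : topologicalType) (X : set T).
Hypothesis finX : finite_set (irreducible_component X).
Hypothesis clX : closed X.
Hypothesis coverX : X `<=` \bigcup_(Z in irreducible_component X) Z.
Context (s : VStab X) (a b : set T).
Hypotheses (ca : irreducible_component X a) (cb : irreducible_component X b).
Implicit Types (Y Z : set T).
Local Open Scope ring_scope.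

Local Notation chi := (vchar s).
Local Notation D Y := `[< degenerate X chi s Y >].
Local Notation "Z `<=b` Y" := `[< Z `<=` Y >] (at level 70).

Definition raise_fun Y : int :=
  if `[< BCon X Y >] then s Y + (D Y && ((a `<=b` Y) && ~~ (b `<=b` Y)))%:Z else 0.

Lemma raise_funE Y : BCon X Y ->
  raise_fun Y = s Y + (D Y && ((a `<=b` Y) && ~~ (b `<=b` Y)))%:Z.
Proof. by move=> bY; rewrite /raise_fun asboolT. Qed.

Lemma sub_complb Y Z : BCon X Y -> irreducible_component X Z ->
  (Z `<=b` compl X Y) = ~~ (Z `<=b` Y).
Proof.
move=> bY cZ; rewrite -asbool_neg; apply: asbool_equiv_eq.
exact: sub_compl (BCon_subcurve bY) cZ.
Qed.

Lemma degenerate_compl Y : BCon X Y ->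
  degenerate X chi s (compl X Y) = degenerate X chi s Y.
Proof.
move=> bY; rewrite /degenerate /defect complK//; last exact: BCon_subcurve.
by rewrite [s Y + _]addrC.
Qed.

(** If Y is degenerate and separates a from b, exactly one of Y and its
    complement is raised. *)
Lemma defect_raise Y : BCon X Y ->
  defect X chi raise_fun Y = defect X chi s Y + (D Y && ((a `<=b` Y) != (b `<=b` Y)))%:Z.
Proof.
move=> bY; have bC : BCon X (compl X Y) by exact: BCon_compl.
rewrite /defect !raise_funE// degenerate_compl// !sub_complb//.
by case: (D Y) (a `<=b` Y) (b `<=b` Y) => [] [] [] /=; lia.
Qed.

Lemma degenerate_raise Y : BCon X Y ->
  degenerate X chi raise_fun Y = (D Y && ((a `<=b` Y) == (b `<=b` Y))) :> Prop.
Proof.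
move=> bY; apply/propext; rewrite {1}/degenerate defect_raise//.
case: asboolP => [->|nD] /=; first by case: eqP.
by rewrite addr0; split=> // /nD.
Qed.

Lemma raise_pair : vstability_pair X chi raise_fun.
Proof.
move=> Y bY; rewrite defect_raise//.
case: asboolP => [->|_] /=; last by rewrite addr0; exact: vfun_pair.
by case: eqP; [left|right].
Qed.

(** Irreducibility puts a component into one of the three members, and into
    only one because they share no component. *)
Lemma component_in_one Y1 Y2 Y3 Z :
  BCon X Y1 -> BCon X Y2 -> BCon X Y3 ->
  no_common_component Y1 Y2 -> no_common_component Y1 Y3 ->
  no_common_component Y2 Y3 -> X = Y1 `|` Y2 `|` Y3 ->
  irreducible_component X Z -> ((Z `<=b` Y1) + (Z `<=b` Y2) + (Z `<=b` Y3) = 1)%N.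
Proof.
move=> /BCon_subcurve s1 /BCon_subcurve s2 /BCon_subcurve s3 n12 n13 n23 XE cZ.
have disj Y Y' : subcurve X Y -> subcurve X Y' -> no_common_component Y Y' ->
    (Z `<=b` Y) && (Z `<=b` Y') = false.
  move=> sY sY' nYY'; apply/negP => /andP[/asboolP ZY /asboolP ZY'].
  by apply: nYY'; exists Z; split; apply: (component_of_subcurve _ cZ).
have cover : [|| Z `<=b` Y1, Z `<=b` Y2 | Z `<=b` Y3].
  have [[_ irrZ] ZX _] := cZ.
  have cl Y := @subcurve_closed _ _ finX clX Y.
  have ZY : Z `<=` Y1 `|` Y2 `|` Y3 by rewrite -XE.
  have [|Z12|Z3] := irrZ _ _ _ (cl _ s3) ZY; first by apply: closedU; exact: cl.
    by have [] := irrZ _ _ (cl _ s1) (cl _ s2) Z12 => /asboolP ->; rewrite ?orbT.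
  by rewrite (asboolT Z3) !orbT.
move: cover (disj _ _ s1 s2 n12) (disj _ _ s1 s3 n13) (disj _ _ s2 s3 n23).
by case: (Z `<=b` Y1) (Z `<=b` Y2) (Z `<=b` Y3) => [] [] [].
Qed.

Lemma raise_triple : vstability_triple X chi raise_fun.
Proof.
move=> Y1 Y2 Y3 b1 b2 b3 n12 n13 n23 XE /=.
have one Z := component_in_one b1 b2 b3 n12 n13 n23 XE (Z := Z).
have rule : triple_rule (s Y1 + s Y2 + s Y3 - chi) (D Y1) (D Y2) (D Y3).
  by rewrite !asboolE; exact: (vfun_triple s b1 b2 b3).
have := triple_rule_raise (one a ca) (one b cb) rule.
rewrite -/(triple_rule _ _ _ _) !degenerate_raise// !raise_funE//.
by congr (triple_rule _ _ _ _); lia.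
Qed.

Definition raise : VStab X.
Proof.
apply: (@MkVStab _ X chi raise_fun _ raise_pair raise_triple) => Y nbY.
by rewrite /raise_fun asboolF.
Defined.

Lemma raise_vle : vle s raise.
Proof. by split=> // Y bY; rewrite /= raise_funE// lerDl. Qed.

Lemma raise_vlt Y : degenerate_locus s Y -> a `<=` Y -> ~ b `<=` Y ->
  vlt s raise.
Proof.
move=> [bY dY] aY nbY; split; first exact: raise_vle.
move=> sE; have := raise_funE bY.
rewrite -[raise_fun Y]/(raise Y) -sE (asboolT dY) (asboolT aY) (asboolF nbY).
by rewrite /=; lia.
Qed.

Lemma degenerate_locus_raise Y : degenerate_locus raise Y <->
  degenerate_locus s Y /\ (a `<=` Y <-> b `<=` Y).
Proof.
rewrite /degenerate_locus /=; split=> [[bY]|[[bY dY] ab]].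
  rewrite degenerate_raise// => /andP[/asboolP dY /eqP ab]; split=> //.
  exact: asbool_eq_equiv.
by split=> //; rewrite degenerate_raise// (asboolT dY) (asbool_equiv_eq ab) eqxx.
Qed.

End Raise.

(** * Maximal and submaximal conditions *)

Section DominationOrder.
Context (T : topologicalType) (X : set T).
Hypothesis finX : finite_set (irreducible_component X).
Hypothesis clX : closed X.
Hypothesis coverX : X `<=` \bigcup_(Z in irreducible_component X) Z.
Implicit Types (Y Z : set T) (s t : VStab X).
Local Open Scope ring_scope.

Lemma degenerate_locus_compl s Y :
  degenerate_locus s Y -> degenerate_locus s (compl X Y).
Proof.
move=> [bY dY]; split; first exact: BCon_compl.
by rewrite degenerate_compl.
Qed.

(** The sum of the values at Y and its complement is at least chi, and it does
    not decrease from s to t; if it is chi for t, it is chi for s. *)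
Lemma vle_degenerate_locus s t : vle s t ->
  degenerate_locus t `<=` degenerate_locus s.
Proof.
move=> [chiE st] Y [bY dY]; split=> //; have bC := BCon_compl finX clX coverX bY.
move: dY (st _ bY) (st _ bC) (vfun_pair s bY).
by rewrite /degenerate /defect chiE; lia.
Qed.

(** Equal loci force equal sums over Y and its complement, and neither of the
    two summands of s exceeds the corresponding one of t. *)
Lemma vle_degenerate_locus_eq s t : vle s t ->
  degenerate_locus s `<=` degenerate_locus t -> s = t.
Proof.
move=> st dst; apply: vle_anti => //; case: st => chiE st; split=> // Y bY.
have bC := BCon_compl finX clX coverX bY.
have dY : defect X (vchar s) s Y = 0 -> defect X (vchar t) t Y = 0.
  by move=> dY; have [] := dst Y (conj bY dY).
move: (st _ bC) (vfun_pair s bY) (vfun_pair t bY) dY.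
by rewrite /defect chiE; lia.
Qed.

(** If Y is degenerate, raising along a component in Y and one outside Y gives a
    strictly larger condition. *)
Lemma vmaximalP s : vmaximal s <-> degenerate_locus s = set0.
Proof.
split=> [max_s|D0 [t [st]]]; last first.
  by apply; apply: vle_degenerate_locus_eq => //; rewrite D0.
apply/seteqP; split=> // Y dY; case: (dY) => bY _; apply: max_s.
have [sY Y0 YX _ _] := bY.
have [a ca aY] := subcurve_neq0 sY Y0.
have [b cb nbY] := subcurve_neqT coverX sY YX.
by exists (raise finX clX coverX s ca cb); exact: raise_vlt dY aY nbY.
Qed.

(** If no such pair exists, Z contains all or none of the components of Y, and
    all or none of those outside Y, so that Z is one of the empty set, Y,
    compl X Y and X. *)
Lemma BCon_separated Y Z : BCon X Y -> BCon X Z -> Z <> Y -> Z <> compl X Y ->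
  exists a b, [/\ irreducible_component X a, irreducible_component X b,
    a `<=` Y <-> b `<=` Y, a `<=` Z & ~ b `<=` Z].
Proof.
move=> bY bZ ZY ZYc; apply: contrapT => nex.
have same a b : irreducible_component X a -> irreducible_component X b ->
    (a `<=` Y <-> b `<=` Y) -> a `<=` Z -> b `<=` Z.
  by move=> ca cb ab aZ; apply: contrapT => nbZ; apply: nex; exists a, b.
have [[sY Y0 YX _ _] [sZ Z0 ZX _ _]] := (bY, bZ).
have [z cz zZ] := subcurve_neq0 sZ Z0.
have [v cv nvZ] := subcurve_neqT coverX sZ ZX.
have sC := compl_subcurve finX clX coverX sY.
have [zY|nzY] := pselect (z `<=` Y).
  apply: ZY; apply: (subcurve_ext sZ sY) => a ca; split=> [aZ|aY].
    apply: contrapT => naY; apply: nvZ.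
    by have [vY|nvY] := pselect (v `<=` Y); [apply: (same z)|apply: (same a)].
  by apply: (same z).
apply: ZYc; apply: (subcurve_ext sZ sC) => a ca.
rewrite sub_compl //; split=> [aZ aY|naY]; last by apply: (same z).
apply: nvZ.
by have [vY|nvY] := pselect (v `<=` Y); [apply: (same a)|apply: (same z)].
Qed.

(** A second degenerate pair Z, compl X Z lets one raise s while keeping Y
    degenerate, and the result is not maximal. Conversely, the locus of a
    condition above s is stable under complement, so when it is nonempty and
    contained in {Y, compl X Y} it equals the locus of s. *)
Lemma vsubmaximalP s : vsubmaximal s <->
  exists2 Y, BCon X Y & degenerate_locus s = [set Y; compl X Y].
Proof.
split=> [[nmax_s sub_s]|[Y bY DE]].
  have /eqP/set0P[Y dY] : degenerate_locus s <> set0 by move/vmaximalP.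
  exists Y; first by case: dY.
  apply/seteqP; split=> [Z dZ|_ [->|->]//]; last exact: degenerate_locus_compl.
  apply: contrapT => /not_orP[ZY ZYc].
  have [a [b [ca cb ab aZ nbZ]]] := BCon_separated dY.1 dZ.1 ZY ZYc.
  have /sub_s/vmaximalP D0 := raise_vlt finX clX coverX ca cb dZ aZ nbZ.
  have : degenerate_locus (raise finX clX coverX s ca cb) Y.
    by apply/degenerate_locus_raise.
  by rewrite D0.
have dY : degenerate_locus s Y by rewrite DE; left.
split=> [/vmaximalP D0|t [st neq]]; first by rewrite D0 in dY.
apply/vmaximalP/seteqP; split=> // Z dZ; apply: neq.
apply: vle_degenerate_locus_eq => //; rewrite DE.
have [ZE|ZE] : Z = Y \/ Z = compl X Y.
- by have := vle_degenerate_locus st dZ; rewrite DE.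
- rewrite ZE in dZ; move=> _ [->|->] //; exact: degenerate_locus_compl.
rewrite ZE in dZ; move=> _ [->|->] //.
rewrite -(complK finX clX coverX (BCon_subcurve bY)).
exact: degenerate_locus_compl.
Qed.

End DominationOrder.

Theorem corollary4p21 (k : closedFieldType) (n : nat) (X : set (pspace k n))
    (curveX : projective_curve X) (connX : connected X) :
  (forall s : VStab X, vmaximal s <-> degenerate_locus s = set0) /\
  (forall s : VStab X, vsubmaximal s <->
    exists2 Y : set (pspace k n), BCon X Y &
      degenerate_locus s = [set Y; compl X Y]).
Proof.
have [clX _ _] := curveX.
have [finX coverX] := finite_irreducible_components (@pspace_noetherian k n) clX.
by split=> s; [exact: vmaximalP|exact: vsubmaximalP].
Qed.
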